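(* The collection of difference associative $2$-algebras as objects, and homomorphisms of difference associative $2$-algebras between them as morphisms (with the composition and identity homomorphisms specified in the context), is a category. (This category is denoted $\mathsf{DiffAss2}$.)
   Context: All vector spaces are over a field $\mathbf{k}$ of characteristic $0$. **2-vector spaces.** A 2-vector space is a category $C=(C_1\rightrightarrows C_0)$ internal to vector spaces: the objects $C_0$ and morphisms $C_1$ form vector spaces, and the source and target maps $s,t:C_1\to C_0$, the identity-assigning map $i:C_0\to C_1$, $x\mapsto i_x$ (also written $1$ or $1_x$), and the composition $C_1\times_{C_0}C_1\to C_1$ are linear. Here $g\circ f$ means first $f$, then $g$. A linear functor $C\to C'$ is a pair $(F_0,F_1)$ of linear maps $F_0:C_0\to C_0'$, $F_1:C_1\to C_1'$ compatible with all the structure maps. A bilinear functor $\bullet:C\times C\to C$ is a functor that is bilinear on objects and on morphisms. A natural isomorphism is called linear (bilinear, trilinear) if its components depend linearly (bilinearly, trilinearly) on the objects. **Associative 2-algebras.** An associative $2$-algebra $(C,\bullet,\mathcal{A})$ is a 2-vector space $C$ with a bilinear functor $\bullet:C\times C\to C$ and a trilinear natural isomorphism $\mathcal{A}_{x,y,z}:(x\bullet y)\bullet z\to x\bullet(y\bullet z)$ such that for all objects $x,y,z,t$ $$(1_x\bullet\mathcal{A}_{y,z,t})\circ\mathcal{A}_{x,y\bullet z,t}\circ(\mathcal{A}_{x,y,z}\bullet 1_t)=\mathcal{A}_{x,y,z\bullet t}\circ\mathcal{A}_{x\bullet y,z,t}.$$ A homomorphism $(C,\bullet,\mathcal{A})\to(C',\bullet',\mathcal{A}')$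 is a triple $(F_0,F_1,F_2)$ with $(F_0,F_1)$ a linear functor and $F_2(x,y):F_0(x)\bullet' F_0(y)\to F_0(x\bullet y)$ a bilinear natural isomorphism such that for all objects $x,y,z$ $$F_2(x,y\bullet z)\circ(1_{F_0(x)}\bullet' F_2(y,z))\circ\mathcal{A}'_{F_0(x),F_0(y),F_0(z)}=F_1(\mathcal{A}_{x,y,z})\circ F_2(x\bullet y,z)\circ(F_2(x,y)\bullet' 1_{F_0(z)}).$$ **Difference associative 2-algebras.** A difference operator on $(C,\bullet,\mathcal{A})$ is a linear functor $D=(D_0,D_1):C\to C$ with a bilinear natural isomorphism $$\mathcal{D}_{x,y}:D_0(x\bullet y)\to D_0(x)\bullet y+x\bullet D_0(y)+D_0(x)\bullet D_0(y)$$ such that for all objects $x,y,z$ the following two morphisms out of $D_0((x\bullet y)\bullet z)$ are equal: $$\big(\mathcal{A}_{D_0(x),y,z}+\mathcal{A}_{x,D_0(y),z}+\mathcal{A}_{D_0(x),D_0(y),z}+\mathcal{A}_{x,y,D_0(z)}+\mathcal{A}_{D_0(x),y,D_0(z)}+\mathcal{A}_{x,D_0(y),D_0(z)}+\mathcal{A}_{D_0(x),D_0(y),D_0(z)}\big)\circ\big(\mathcal{D}_{x,y}\bullet 1_z+1_{(x\bullet y)\bullet D_0(z)}+\mathcal{D}_{x,y}\bullet 1_{D_0(z)}\big)\circ\mathcal{D}_{x\bullet y,z}$$ and $$\big(1_{D_0(x)\bullet(y\bullet z)}+1_x\bullet\mathcal{D}_{y,z}+1_{D_0(x)}\bullet\mathcal{D}_{y,z}\big)\circ\mathcal{D}_{x,y\bullet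 z}\circ D_1(\mathcal{A}_{x,y,z}).$$ The tuple $((C,\bullet,\mathcal{A}),D,\mathcal{D})$, or $(C,D,\mathcal{D})$, is called a difference associative $2$-algebra. A homomorphism of difference associative $2$-algebras $(C,D,\mathcal{D})\to(C',D',\mathcal{D}')$ is a tuple $F=(F_0,F_1,F_2,F_3)$ where $(F_0,F_1,F_2)$ is a homomorphism of the underlying associative $2$-algebras and $F_3(x):D_0'(F_0(x))\to F_0(D_0(x))$ is a linear natural isomorphism such that for all objects $x,y$ $$F_1(\mathcal{D}_{x,y})\circ F_3(x\bullet y)\circ D_1'(F_2(x,y))=\big(F_2(D_0(x),y)+F_2(x,D_0(y))+F_2(D_0(x),D_0(y))\big)\circ\big(F_3(x)\bullet'1_{F_0(y)}+1_{F_0(x)}\bullet'F_3(y)+F_3(x)\bullet'F_3(y)\big)\circ\mathcal{D}'_{F_0(x),F_0(y)}.$$ **Composition and identities.** For $F:(C,D,\mathcal{D})\to(C',D',\mathcal{D}')$ and $G:(C',D',\mathcal{D}')\to(C'',D'',\mathcal{D}'')$, the composite $G\circ F:(C,D,\mathcal{D})\to(C'',D'',\mathcal{D}'')$ has $(G\circ F)_0=G_0\circ F_0$, $(G\circ F)_1=G_1\circ F_1$, $(G\circ F)_2(x,y)=G_1(F_2(x,y))\circ G_2(F_0(x),F_0(y))$ and $(G\circ F)_3(x)=G_1(F_3(x))\circ G_3(F_0(x))$. The identity homomorphism has the identity linear functor as underlying functor, and identity natural transformations as its second and third components. *)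

(* Defs.v *)
From HB Require Import structures.
From mathcomp Require Import all_boot all_order all_algebra.

Set Implicit Arguments.
Unset Strict Implicit.
Unset Printing Implicit Defensive.

Import GRing.Theory.
Local Open Scope ring_scope.

(* The fibre product U x_W V of two linear maps, as a vector space: a subspace
   of U * V. *)
Section FibreProduct.
Variables (k : fieldType) (U V W : lmodType k).
Variables (f : {linear U -> W}) (g : {linear V -> W}).

Definition fibre_pred : {pred U * V} := fun p => f p.1 == g p.2.

Lemma fibre_submod_closed : submod_closed fibre_pred.
Proof.
split=> [|a p q]; rewrite !unfold_in /=; first by rewrite !linear0.
by move=> /eqP hp /eqP hq; rewrite !linearP hp hq.
Qed.

HB.instance Definition _ :=
  GRing.isSubmodClosed.Build k (U * V)%type fibre_pred
    (GRing.submod_closed_semi fibre_submod_closed).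

Record fibre := Fibre { fibre_val : (U * V)%type; _ : fibre_val \in fibre_pred }.

HB.instance Definition _ := [isSub of fibre for fibre_val].
HB.instance Definition _ := [Choice of fibre by <:].
HB.instance Definition _ := [SubChoice_isSubLmodule of fibre by <:].

End FibreProduct.

(* A composition on C1 x_{C0} C1, extended by 0 to the pairs (g, f) with
   s g <> t f.  In every equation below the composites are of composable
   morphisms, by the conditions on sources and targets, so the value 0 is
   irrelevant; it only avoids carrying composability proofs in formulas. *)
Definition compose (k : fieldType) (C0 C1 : lmodType k)
    (s t : {linear C1 -> C0}) (c : {linear fibre s t -> C1}) (g f : C1) : C1 :=
  if insub (g, f) is Some p then c p else 0.

Record two_vect (k : fieldType) := TwoVect {
  ob : lmodType k;
  mor : lmodType k;
  src : {linear mor -> ob};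
  tgt : {linear mor -> ob};
  idm : {linear ob -> mor};
  comp_map : {linear fibre src tgt -> mor};
  src_id : forall x, src (idm x) = x;
  tgt_id : forall x, tgt (idm x) = x;
  src_comp : forall g f, src g = tgt f -> src (compose comp_map g f) = src f;
  tgt_comp : forall g f, src g = tgt f -> tgt (compose comp_map g f) = tgt g;
  comp_idr : forall f, compose comp_map f (idm (src f)) = f;
  comp_idl : forall f, compose comp_map (idm (tgt f)) f = f;
  comp_assoc : forall h g f, src h = tgt g -> src g = tgt f ->
    compose comp_map h (compose comp_map g f)
    = compose comp_map (compose comp_map h g) f
}.

Arguments src {k C} : rename.
Arguments tgt {k C} : rename.
Arguments idm {k C} : rename.

Definition compm (k : fieldType) (C : two_vect k) : mor C -> mor C -> mor C :=
  compose (comp_map C).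

(* First f, then g. *)
Notation "g \oc f" := (compm g f) (at level 45, left associativity).
Notation "f \is_arrow x ~> y" := (src f = x /\ tgt f = y)
  (at level 70, x at next level, y at next level).

Definition is_iso (k : fieldType) (C : two_vect k) (f : mor C) : Prop :=
  exists g : mor C, [/\ g \is_arrow tgt f ~> src f,
    g \oc f = idm (src f) & f \oc g = idm (tgt f)].

Record is_functor (k : fieldType) (C C' : two_vect k)
    (F0 : {linear ob C -> ob C'}) (F1 : {linear mor C -> mor C'}) : Prop := {
  functor_src : forall f, src (F1 f) = F0 (src f);
  functor_tgt : forall f, tgt (F1 f) = F0 (tgt f);
  functor_id : forall x, F1 (idm x) = idm (F0 x);
  functor_comp : forall g f, src g = tgt f -> F1 (g \oc f) = F1 g \oc F1 f
}.

Record is_bifunctor (k : fieldType) (C : two_vect k)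
    (m0 : {bilinear ob C -> ob C -> ob C})
    (m1 : {bilinear mor C -> mor C -> mor C}) : Prop := {
  bifunctor_src : forall f g, src (m1 f g) = m0 (src f) (src g);
  bifunctor_tgt : forall f g, tgt (m1 f g) = m0 (tgt f) (tgt g);
  bifunctor_id : forall x y, m1 (idm x) (idm y) = idm (m0 x y);
  bifunctor_comp : forall f' f g' g, src f' = tgt f -> src g' = tgt g ->
    m1 (f' \oc f) (g' \oc g) = m1 f' g' \oc m1 f g
}.

Definition bilinear2 (k : fieldType) (U V W : lmodType k)
    (a : U -> V -> W) : Prop :=
  (forall y, linear (a ^~ y)) /\ (forall x, linear (a x)).

Definition trilinear3 (k : fieldType) (T U V W : lmodType k)
    (a : T -> U -> V -> W) : Prop :=
  [/\ forall y z, linear (fun x => a x y z),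
      forall x z, linear (fun y => a x y z) &
      forall x y, linear (fun z => a x y z)].

(* Linear, bilinear and trilinear natural isomorphisms from a functor (F0, F1)
   to a functor (G0, G1) of one, two or three variables in C with values in
   C'; the functors are given by their actions on objects and morphisms. *)
Record lin_natiso (k : fieldType) (C C' : two_vect k)
    (F0 G0 : ob C -> ob C') (F1 G1 : mor C -> mor C')
    (a : ob C -> mor C') : Prop := {
  lin_natiso_arrow : forall x, a x \is_arrow F0 x ~> G0 x;
  lin_natiso_iso : forall x, is_iso (a x);
  lin_natiso_linear : linear a;
  lin_natiso_natural : forall f,
    a (tgt f) \oc F1 f = G1 f \oc a (src f)
}.

Record bilin_natiso (k : fieldType) (C C' : two_vect k)
    (F0 G0 : ob C -> ob C -> ob C') (F1 G1 : mor C -> mor C -> mor C')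
    (a : ob C -> ob C -> mor C') : Prop := {
  bilin_natiso_arrow : forall x y, a x y \is_arrow F0 x y ~> G0 x y;
  bilin_natiso_iso : forall x y, is_iso (a x y);
  bilin_natiso_linear : bilinear2 a;
  bilin_natiso_natural : forall f g,
    a (tgt f) (tgt g) \oc F1 f g = G1 f g \oc a (src f) (src g)
}.

Record trilin_natiso (k : fieldType) (C C' : two_vect k)
    (F0 G0 : ob C -> ob C -> ob C -> ob C')
    (F1 G1 : mor C -> mor C -> mor C -> mor C')
    (a : ob C -> ob C -> ob C -> mor C') : Prop := {
  trilin_natiso_arrow : forall x y z, a x y z \is_arrow F0 x y z ~> G0 x y z;
  trilin_natiso_iso : forall x y z, is_iso (a x y z);
  trilin_natiso_linear : trilinear3 a;
  trilin_natiso_natural : forall f g h,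
    a (tgt f) (tgt g) (tgt h) \oc F1 f g h
    = G1 f g h \oc a (src f) (src g) (src h)
}.

Record ass2 (k : fieldType) := Ass2 {
  ass2_vect :> two_vect k;
  mul0 : {bilinear ob ass2_vect -> ob ass2_vect -> ob ass2_vect};
  mul1 : {bilinear mor ass2_vect -> mor ass2_vect -> mor ass2_vect};
  assoc : ob ass2_vect -> ob ass2_vect -> ob ass2_vect -> mor ass2_vect;
  mul_functor : is_bifunctor mul0 mul1;
  assoc_natiso : trilin_natiso
    (fun x y z => mul0 (mul0 x y) z) (fun x y z => mul0 x (mul0 y z))
    (fun f g h => mul1 (mul1 f g) h) (fun f g h => mul1 f (mul1 g h))
    assoc;
  assoc_coherence : forall x y z t,
    mul1 (idm x) (assoc y z t) \oc assoc x (mul0 y z) t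
      \oc mul1 (assoc x y z) (idm t)
    = assoc x y (mul0 z t) \oc assoc (mul0 x y) z t
}.

Arguments mul0 {k C} : rename.
Arguments mul1 {k C} : rename.
Arguments assoc {k C} : rename.

Notation "x \b0 y" := (mul0 x y) (at level 40, left associativity).
Notation "f \b1 g" := (mul1 f g) (at level 40, left associativity).

Record is_ass2_hom (k : fieldType) (C C' : ass2 k)
    (F0 : {linear ob C -> ob C'}) (F1 : {linear mor C -> mor C'})
    (F2 : ob C -> ob C -> mor C') : Prop := {
  ass2_hom_functor : is_functor F0 F1;
  ass2_hom_natiso : bilin_natiso
    (fun x y => F0 x \b0 F0 y) (fun x y => F0 (x \b0 y))
    (fun f g => F1 f \b1 F1 g) (fun f g => F1 (f \b1 g)) F2;
  ass2_hom_coherence : forall x y z,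
    F2 x (y \b0 z) \oc (idm (F0 x) \b1 F2 y z) \oc assoc (F0 x) (F0 y) (F0 z)
    = F1 (assoc x y z) \oc F2 (x \b0 y) z \oc (F2 x y \b1 idm (F0 z))
}.

Record is_difference (k : fieldType) (C : ass2 k)
    (D0 : {linear ob C -> ob C}) (D1 : {linear mor C -> mor C})
    (DD : ob C -> ob C -> mor C) : Prop := {
  difference_functor : is_functor D0 D1;
  difference_natiso : bilin_natiso
    (fun x y => D0 (x \b0 y))
    (fun x y => D0 x \b0 y + x \b0 D0 y + D0 x \b0 D0 y)
    (fun f g => D1 (f \b1 g))
    (fun f g => D1 f \b1 g + f \b1 D1 g + D1 f \b1 D1 g) DD;
  difference_coherence : forall x y z,
    (assoc (D0 x) y z + assoc x (D0 y) z + assoc (D0 x) (D0 y) z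
      + assoc x y (D0 z) + assoc (D0 x) y (D0 z) + assoc x (D0 y) (D0 z)
      + assoc (D0 x) (D0 y) (D0 z))
    \oc (DD x y \b1 idm z + idm ((x \b0 y) \b0 D0 z) + DD x y \b1 idm (D0 z))
    \oc DD (x \b0 y) z
    = (idm (D0 x \b0 (y \b0 z)) + idm x \b1 DD y z + idm (D0 x) \b1 DD y z)
      \oc DD x (y \b0 z) \oc D1 (assoc x y z)
}.

Record diff_ass2 (k : fieldType) := DiffAss2 {
  diff_ass2_alg :> ass2 k;
  dif0 : {linear ob diff_ass2_alg -> ob diff_ass2_alg};
  dif1 : {linear mor diff_ass2_alg -> mor diff_ass2_alg};
  dif2 : ob diff_ass2_alg -> ob diff_ass2_alg -> mor diff_ass2_alg;
  dif_is_difference : is_difference dif0 dif1 dif2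
}.

Arguments dif0 {k A} : rename.
Arguments dif1 {k A} : rename.
Arguments dif2 {k A} : rename.

Record hom_data (k : fieldType) (A B : diff_ass2 k) := HomData {
  hom0 : {linear ob A -> ob B};
  hom1 : {linear mor A -> mor B};
  hom2 : ob A -> ob A -> mor B;
  hom3 : ob A -> mor B
}.

Record is_diff_hom (k : fieldType) (A B : diff_ass2 k)
    (F : hom_data A B) : Prop := {
  diff_hom_ass2_hom : is_ass2_hom (hom0 F) (hom1 F) (hom2 F);
  diff_hom_natiso : lin_natiso
    (fun x => dif0 (hom0 F x)) (fun x => hom0 F (dif0 x))
    (fun f => dif1 (hom1 F f)) (fun f => hom1 F (dif1 f)) (hom3 F);
  diff_hom_coherence : forall x y,
    hom1 F (dif2 x y) \oc hom3 F (x \b0 y) \oc dif1 (hom2 F x y)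
    = (hom2 F (dif0 x) y + hom2 F x (dif0 y) + hom2 F (dif0 x) (dif0 y))
      \oc (hom3 F x \b1 idm (hom0 F y) + idm (hom0 F x) \b1 hom3 F y
           + hom3 F x \b1 hom3 F y)
      \oc dif2 (hom0 F x) (hom0 F y)
}.

Record diff_hom (k : fieldType) (A B : diff_ass2 k) := DiffHom {
  diff_hom_data :> hom_data A B;
  diff_hom_is_hom : is_diff_hom diff_hom_data
}.

Definition comp_data (k : fieldType) (A B C : diff_ass2 k)
    (G : hom_data B C) (F : hom_data A B) : hom_data A C :=
  {| hom0 := hom0 G \o hom0 F;
     hom1 := hom1 G \o hom1 F;
     hom2 := fun x y => hom1 G (hom2 F x y) \oc hom2 G (hom0 F x) (hom0 F y);
     hom3 := fun x => hom1 G (hom3 F x) \oc hom3 G (hom0 F x) |}.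

Definition id_data (k : fieldType) (A : diff_ass2 k) : hom_data A A :=
  {| hom0 := idfun;
     hom1 := idfun;
     hom2 := fun x y => idm (x \b0 y);
     hom3 := fun x => idm (dif0 x) |}.

Record is_category (Ob : Type) (Hom : Ob -> Ob -> Type)
    (id : forall A, Hom A A)
    (comp : forall A B C, Hom B C -> Hom A B -> Hom A C) : Prop := {
  category_idl : forall A B (F : Hom A B), comp _ _ _ (id B) F = F;
  category_idr : forall A B (F : Hom A B), comp _ _ _ F (id A) = F;
  category_assoc : forall A B C D
      (H : Hom C D) (G : Hom B C) (F : Hom A B),
    comp _ _ _ H (comp _ _ _ G F) = comp _ _ _ (comp _ _ _ H G) F
}.

(* Main.v *)
Require Import Defs.
From mathcomp Require Import all_boot all_order all_algebra.
From Stdlib Require Import FunctionalExtensionality ProofIrrelevance.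
Import GRing.Theory.
Local Open Scope ring_scope.

(** The category laws reduce to unitality and associativity of composition of
    arrows in the 2-vector spaces ([compm1], [comp1m], [functor_compmA]), once
    homomorphisms are compared by their underlying data ([diff_hom_ext]). The
    substance is that identities and composites are homomorphisms
    ([id_diff_hom], [comp_diff_hom]).

    Composition of arrows is linear on composable pairs, so that a sum of
    composites is the composite of the sums ([compmD]), and every arrow is
    invertible ([all_iso]). The second and third components of a composite G o F
    are vertical composites of whiskered natural isomorphisms, hence natural
    isomorphisms ([bilin_natiso_vcomp], [lin_natiso_vcomp]).

    The coherence diagram of G o F is, in both cases, the image under G1 of the
    diagram of F pasted to the diagram of G at the objects F0 x, along
    naturality squares of G2 and G3. For the associator this is
    [comp_ass2_hom]. For the difference operator the diagram involves sums of
    three arrows, of the shape (x + x') (y + y') - x y of the rule for D (x y);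
    by the interchange law such a sum behaves functorially ([mul1_leibniz]), so
    that the three summands are pasted simultaneously. *)

Set Implicit Arguments.
Unset Strict Implicit.
Unset Printing Implicit Defensive.

(** * Composition in a 2-vector space *)

Section TwoVect.
Variables (k : fieldType) (C : two_vect k).
Implicit Types (f g h : mor C) (x : ob C).

(** The fibre product is a subspace of the product, so the composition, which is
    linear on it, commutes with linear combinations of composable pairs. *)
Lemma compm_linear (c : k) g g' f f' : src g = tgt f -> src g' = tgt f' ->
  (c *: g + g') \oc (c *: f + f') = c *: (g \oc f) + g' \oc f'.
Proof.
move=> e e'; rewrite /compm /compose.
have inF u v : src u = tgt v -> (u, v) \in fibre_pred (@src k C) (@tgt k C).
  by move=> euv; rewrite unfold_in /= euv.
have e'' : src (c *: g + g') = tgt (c *: f + f') by rewrite !linearP e e'.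
rewrite !insubT ?inF // => i1 i2 i3.
rewrite -linearP; congr (comp_map C _).
by apply: val_inj; rewrite /= ?SubK.
Qed.

(** The interchange law of addition and composition; it lets sums of arrows be
    pasted as if they were single arrows. *)
Lemma compmD g g' f f' : src g = tgt f -> src g' = tgt f' ->
  (g \oc f) + (g' \oc f') = (g + g') \oc (f + f').
Proof. by move=> e e'; have := compm_linear 1 e e'; rewrite !scale1r. Qed.

Lemma src_compm g f : src g = tgt f -> src (g \oc f) = src f.
Proof. exact: src_comp. Qed.

Lemma tgt_compm g f : src g = tgt f -> tgt (g \oc f) = tgt g.
Proof. exact: tgt_comp. Qed.

Lemma compm1 f x : src f = x -> f \oc idm x = f.
Proof. by move<-; apply: comp_idr. Qed.

Lemma comp1m f x : tgt f = x -> idm x \oc f = f.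
Proof. by move<-; apply: comp_idl. Qed.

Lemma compmA h g f : src h = tgt g -> src g = tgt f ->
  h \oc (g \oc f) = h \oc g \oc f.
Proof. exact: comp_assoc. Qed.

(** Split the composable pair (g, f) as (g, 1) + (0, f - 1), where 0 is the
    identity of the object 0. *)
Lemma compmE g f : src g = tgt f -> g \oc f = g + (f - idm (src g)).
Proof.
move=> e; have t0 : tgt (f - idm (src g)) = 0.
  by rewrite linearB /= tgt_id e subrr.
transitivity ((g \oc idm (src g)) + (idm 0 \oc (f - idm (src g)))).
  by rewrite compmD ?src_id ?tgt_id ?t0 // linear0 addr0 addrC subrK.
by rewrite compm1 // comp1m.
Qed.

(** A 2-vector space is a groupoid: with 1 the identities of the two ends of f,
    the arrow 1 - (f - 1) has the ends of an inverse of f, and the formula for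
    composites shows that it is one. Hence invertibility of the components of
    a natural isomorphism is automatic. *)
Lemma all_iso f : is_iso f.
Proof.
pose g := idm (tgt f) - (f - idm (src f)).
have sg : src g = tgt f by rewrite !linearB /= !src_id subrr addr0.
have tg : tgt g = src f by rewrite !linearB /= !tgt_id addrA subrr add0r opprK.
exists g; split=> //; rewrite compmE // ?sg.
  by rewrite /g addrC addrA subrK opprB addrC subrK.
by rewrite /g opprB -addrA addrAC subrr sub0r subrKC.
Qed.

End TwoVect.

(** * Functors and natural transformations *)

Lemma id_functor (k : fieldType) (C : two_vect k) :
  @is_functor k C C idfun idfun.
Proof. by split. Qed.

Lemma comp_functor (k : fieldType) (A B C : two_vect k)
    (F0 : {linear ob A -> ob B}) (F1 : {linear mor A -> mor B})
    (G0 : {linear ob B -> ob C}) (G1 : {linear mor B -> mor C}) :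
  is_functor F0 F1 -> is_functor G0 G1 -> is_functor (G0 \o F0) (G1 \o F1).
Proof.
move=> hF hG; split=> [f|f|x|g f e] /=.
- by rewrite (functor_src hG) (functor_src hF).
- by rewrite (functor_tgt hG) (functor_tgt hF).
- by rewrite (functor_id hF) (functor_id hG).
- rewrite (functor_comp hF) // (functor_comp hG) //.
  by rewrite (functor_src hF) (functor_tgt hF) e.
Qed.

(** The shape of associativity for the second and third components of composite
    homomorphisms. *)
Lemma functor_compmA (k : fieldType) (C C' : two_vect k)
    (F0 : {linear ob C -> ob C'}) (F1 : {linear mor C -> mor C'})
    (g f : mor C) (h : mor C') :
  is_functor F0 F1 -> src g = tgt f -> F0 (src f) = tgt h ->
  F1 (g \oc f) \oc h = F1 g \oc (F1 f \oc h).
Proof.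
move=> hF e e'; rewrite (functor_comp hF) // -compmA //.
  by rewrite (functor_src hF) (functor_tgt hF) e.
by rewrite (functor_src hF) e'.
Qed.

(** The functors of a natural isomorphism are only given by their actions, so
    that the arrows which they produce have the expected ends is recorded
    separately; composability of the naturality squares depends on it. *)
Definition preserves_ends (k : fieldType) (C C' : two_vect k)
    (F0 : ob C -> ob C') (F1 : mor C -> mor C') : Prop :=
  forall f, F1 f \is_arrow F0 (src f) ~> F0 (tgt f).

Definition preserves_ends2 (k : fieldType) (C C' : two_vect k)
    (F0 : ob C -> ob C -> ob C') (F1 : mor C -> mor C -> mor C') : Prop :=
  forall f g, F1 f g \is_arrow F0 (src f) (src g) ~> F0 (tgt f) (tgt g).

Lemma functor_ends (k : fieldType) (C C' : two_vect k)
    (F0 : {linear ob C -> ob C'}) (F1 : {linear mor C -> mor C'}) :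
  is_functor F0 F1 -> preserves_ends F0 F1.
Proof. by move=> hF f; rewrite (functor_src hF) (functor_tgt hF). Qed.

Section LinNatIso.
Variables (k : fieldType) (B C D : two_vect k).

Lemma lin_natiso_id (F0 : {linear ob C -> ob D}) (F1 : mor C -> mor D) :
  preserves_ends F0 F1 -> lin_natiso F0 F0 F1 F1 (fun x => idm (F0 x)).
Proof.
move=> eF; split=> [x|x|c x y|f]; rewrite ?src_id ?tgt_id //.
- exact: all_iso.
- by rewrite !linearP.
- by rewrite comp1m ?compm1 ?(proj1 (eF f)) ?(proj2 (eF f)).
Qed.

Lemma lin_natiso_vcomp (F0 G0 H0 : ob C -> ob D) (F1 G1 H1 : mor C -> mor D)
    (a b : ob C -> mor D) :
  preserves_ends F0 F1 -> preserves_ends G0 G1 -> preserves_ends H0 H1 ->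
  lin_natiso F0 G0 F1 G1 a -> lin_natiso G0 H0 G1 H1 b ->
  lin_natiso F0 H0 F1 H1 (fun x => b x \oc a x).
Proof.
move=> eF eG eH [aa _ la na] [ab _ lb nb].
have sa x := proj1 (aa x); have ta x := proj2 (aa x).
have sb x := proj1 (ab x); have tb x := proj2 (ab x).
split=> [x|x|c x y|f].
- by rewrite src_compm ?tgt_compm ?sa ?sb.
- exact: all_iso.
- by rewrite la lb compm_linear ?ta ?sb.
- have [sF tF] := eF f; have [sG tG] := eG f; have [sH tH] := eH f.
  rewrite -compmA ?sb ?ta ?sa ?tF // na compmA ?sb ?tG ?sG ?ta //.
  by rewrite nb compmA ?sH ?tb ?sb ?ta.
Qed.

Lemma lin_natiso_post (F0 G0 : ob B -> ob C) (F1 G1 : mor B -> mor C)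
    (a : ob B -> mor C) (H0 : {linear ob C -> ob D})
    (H1 : {linear mor C -> mor D}) :
  is_functor H0 H1 -> preserves_ends F0 F1 -> preserves_ends G0 G1 ->
  lin_natiso F0 G0 F1 G1 a ->
  lin_natiso (fun x => H0 (F0 x)) (fun x => H0 (G0 x))
    (fun f => H1 (F1 f)) (fun f => H1 (G1 f)) (fun x => H1 (a x)).
Proof.
move=> hH eF eG [aa _ la na].
have sa x := proj1 (aa x); have ta x := proj2 (aa x).
split=> [x|x|c x y|f].
- by rewrite (functor_src hH) (functor_tgt hH) sa ta.
- exact: all_iso.
- by rewrite la linearP.
- have [sF tF] := eF f; have [sG tG] := eG f.
  by rewrite -!(functor_comp hH) ?sa ?ta ?tF ?sG // na.
Qed.

Lemma lin_natiso_pre (F0 G0 : ob C -> ob D) (F1 G1 : mor C -> mor D)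
    (a : ob C -> mor D) (H0 : {linear ob B -> ob C})
    (H1 : {linear mor B -> mor C}) :
  is_functor H0 H1 -> lin_natiso F0 G0 F1 G1 a ->
  lin_natiso (fun x => F0 (H0 x)) (fun x => G0 (H0 x))
    (fun f => F1 (H1 f)) (fun f => G1 (H1 f)) (fun x => a (H0 x)).
Proof.
move=> hH [aa _ la na]; split=> [x|x|c x y|f].
- exact: aa.
- exact: all_iso.
- by rewrite linearP la.
- by rewrite -(functor_src hH) -(functor_tgt hH) na.
Qed.

End LinNatIso.

Section BilinNatIso.
Variables (k : fieldType) (B C D : two_vect k).

Lemma bilin_natiso_id (F0 : {bilinear ob C -> ob C -> ob D})
    (F1 : mor C -> mor C -> mor D) :
  preserves_ends2 F0 F1 ->
  bilin_natiso F0 F0 F1 F1 (fun x y => idm (F0 x y)).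
Proof.
move=> eF; split=> [x y|x y||f g]; rewrite ?src_id ?tgt_id //.
- exact: all_iso.
- by split=> [y c x x'|x c y y'] /=; rewrite ?linearPl ?linearPr linearP.
- by rewrite comp1m ?compm1 ?(proj1 (eF f g)) ?(proj2 (eF f g)).
Qed.

Lemma bilin_natiso_vcomp (F0 G0 H0 : ob C -> ob C -> ob D)
    (F1 G1 H1 : mor C -> mor C -> mor D) (a b : ob C -> ob C -> mor D) :
  preserves_ends2 F0 F1 -> preserves_ends2 G0 G1 -> preserves_ends2 H0 H1 ->
  bilin_natiso F0 G0 F1 G1 a -> bilin_natiso G0 H0 G1 H1 b ->
  bilin_natiso F0 H0 F1 H1 (fun x y => b x y \oc a x y).
Proof.
move=> eF eG eH [aa _ [la la'] na] [ab _ [lb lb'] nb].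
have sa x y := proj1 (aa x y); have ta x y := proj2 (aa x y).
have sb x y := proj1 (ab x y); have tb x y := proj2 (ab x y).
split=> [x y|x y||f g].
- by rewrite src_compm ?tgt_compm ?sa ?sb.
- exact: all_iso.
- split=> [y c x x'|x c y y'] /=.
    by rewrite la lb compm_linear ?ta ?sb.
  by rewrite la' lb' compm_linear ?ta ?sb.
- have [sF tF] := eF f g; have [sG tG] := eG f g; have [sH tH] := eH f g.
  rewrite -compmA ?sb ?ta ?sa ?tF // na compmA ?sb ?tG ?sG ?ta //.
  by rewrite nb compmA ?sH ?tb ?sb ?ta.
Qed.

Lemma bilin_natiso_post (F0 G0 : ob B -> ob B -> ob C)
    (F1 G1 : mor B -> mor B -> mor C) (a : ob B -> ob B -> mor C)
    (H0 : {linear ob C -> ob D}) (H1 : {linear mor C -> mor D}) :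
  is_functor H0 H1 -> preserves_ends2 F0 F1 -> preserves_ends2 G0 G1 ->
  bilin_natiso F0 G0 F1 G1 a ->
  bilin_natiso (fun x y => H0 (F0 x y)) (fun x y => H0 (G0 x y))
    (fun f g => H1 (F1 f g)) (fun f g => H1 (G1 f g)) (fun x y => H1 (a x y)).
Proof.
move=> hH eF eG [aa _ [la la'] na].
have sa x y := proj1 (aa x y); have ta x y := proj2 (aa x y).
split=> [x y|x y||f g].
- by rewrite (functor_src hH) (functor_tgt hH) sa ta.
- exact: all_iso.
- by split=> [y c x x'|x c y y'] /=; rewrite ?la ?la' linearP.
- have [sF tF] := eF f g; have [sG tG] := eG f g.
  by rewrite -!(functor_comp hH) ?sa ?ta ?tF ?sG // na.
Qed.

Lemma bilin_natiso_pre (F0 G0 : ob C -> ob C -> ob D)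
    (F1 G1 : mor C -> mor C -> mor D) (a : ob C -> ob C -> mor D)
    (H0 : {linear ob B -> ob C}) (H1 : {linear mor B -> mor C}) :
  is_functor H0 H1 -> bilin_natiso F0 G0 F1 G1 a ->
  bilin_natiso (fun x y => F0 (H0 x) (H0 y)) (fun x y => G0 (H0 x) (H0 y))
    (fun f g => F1 (H1 f) (H1 g)) (fun f g => G1 (H1 f) (H1 g))
    (fun x y => a (H0 x) (H0 y)).
Proof.
move=> hH [aa _ [la la'] na]; split=> [x y|x y||f g].
- exact: aa.
- exact: all_iso.
- by split=> [y c x x'|x c y y'] /=; rewrite linearP ?la ?la'.
- by rewrite -!(functor_src hH) -!(functor_tgt hH) na.
Qed.

End BilinNatIso.

(** * Homomorphisms of associative 2-algebras *)

(** Computes sources and targets of composite arrows, by the rules R for the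
    atoms, and proves the equations between them that composability requires. *)
Ltac ends R :=
  try done; repeat progress
    (rewrite ?R ?linearD ?src_id ?tgt_id //=;
     try (rewrite src_compm; [|by ends R]);
     try (rewrite tgt_compm; [|by ends R])).

Section Ass2.
Variables (k : fieldType) (C : ass2 k).
Implicit Types (f g : mor C) (x y : ob C).

Lemma src_mul1 f g : src (f \b1 g) = src f \b0 src g.
Proof. exact: (bifunctor_src (mul_functor C)). Qed.

Lemma tgt_mul1 f g : tgt (f \b1 g) = tgt f \b0 tgt g.
Proof. exact: (bifunctor_tgt (mul_functor C)). Qed.

Lemma mul1_id x y : idm x \b1 idm y = idm (x \b0 y).
Proof. exact: (bifunctor_id (mul_functor C)). Qed.

Lemma mul1_compm f' f g' g : src f' = tgt f -> src g' = tgt g ->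
  (f' \oc f) \b1 (g' \oc g) = (f' \b1 g') \oc (f \b1 g).
Proof. exact: (bifunctor_comp (mul_functor C)). Qed.

Lemma src_assoc x y z : src (assoc x y z) = x \b0 y \b0 z.
Proof. exact: (proj1 (trilin_natiso_arrow (assoc_natiso C) x y z)). Qed.

Lemma tgt_assoc x y z : tgt (assoc x y z) = x \b0 (y \b0 z).
Proof. exact: (proj2 (trilin_natiso_arrow (assoc_natiso C) x y z)). Qed.

Lemma mul1_id_compm x f g : src f = tgt g ->
  idm x \b1 (f \oc g) = (idm x \b1 f) \oc (idm x \b1 g).
Proof.
by move=> e; rewrite -mul1_compm ?src_id ?tgt_id // compm1 ?src_id.
Qed.

Lemma mul1_compm_id x f g : src f = tgt g ->
  (f \oc g) \b1 idm x = (f \b1 idm x) \oc (g \b1 idm x).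
Proof.
by move=> e; rewrite -mul1_compm ?src_id ?tgt_id // compm1 ?src_id.
Qed.

Lemma id_ass2_hom : @is_ass2_hom k C C idfun idfun (fun x y => idm (x \b0 y)).
Proof.
split; first exact: id_functor.
  by apply: bilin_natiso_id => f g; rewrite src_mul1 tgt_mul1.
move=> x y z /=; have R := (src_mul1, tgt_mul1, src_assoc, tgt_assoc).
by rewrite !mul1_id !comp1m ?compm1; ends R.
Qed.

End Ass2.

Section Ass2Comp.
Variables (k : fieldType) (A B C : ass2 k).
Variables (F0 : {linear ob A -> ob B}) (F1 : {linear mor A -> mor B}).
Variables (G0 : {linear ob B -> ob C}) (G1 : {linear mor B -> mor C}).
Variables (F2 : ob A -> ob A -> mor B) (G2 : ob B -> ob B -> mor C).
Hypotheses (hF : is_ass2_hom F0 F1 F2) (hG : is_ass2_hom G0 G1 G2).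

(** Naturality of G2 against the arrow (1, F2(y, z)) moves the G1-images on the
    left side together and leaves one side of the hexagon of G at F0 x, F0 y,
    F0 z. The other side of that hexagon starts with the G1-image of an
    associator, which completes the G1-images to the image of the hexagon of F.
    Naturality of G2 against (F2(x, y), 1) then interleaves the components of
    F2 and G2 again. *)
Lemma comp_ass2_hom : is_ass2_hom (G0 \o F0) (G1 \o F1)
  (fun x y => G1 (F2 x y) \oc G2 (F0 x) (F0 y)).
Proof.
have [fF nF cF] := hF; have [fG nG cG] := hG.
have sF2 x y := proj1 (bilin_natiso_arrow nF x y).
have tF2 x y := proj2 (bilin_natiso_arrow nF x y).
have sG2 x y := proj1 (bilin_natiso_arrow nG x y).
have tG2 x y := proj2 (bilin_natiso_arrow nG x y).
have R := (functor_src fF, functor_tgt fF, functor_src fG, functor_tgt fG,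
  sF2, tF2, sG2, tG2, src_mul1, tgt_mul1, src_assoc, tgt_assoc).
split; first exact: comp_functor.
  have nGF := bilin_natiso_pre fF nG.
  have GnF := bilin_natiso_post fG _ _ nF.
  apply: bilin_natiso_vcomp nGF (GnF _ _) => f g; split; by ends R.
move=> x y z /=.
have natl : G2 (F0 x) (F0 (y \b0 z)) \oc (idm (G0 (F0 x)) \b1 G1 (F2 y z))
    = G1 (idm (F0 x) \b1 F2 y z) \oc G2 (F0 x) (F0 y \b0 F0 z).
  have := bilin_natiso_natural nG (idm (F0 x)) (F2 y z).
  by rewrite /= !R !src_id !tgt_id (functor_id fG).
have natr : G2 (F0 (x \b0 y)) (F0 z) \oc (G1 (F2 x y) \b1 idm (G0 (F0 z)))
    = G1 (F2 x y \b1 idm (F0 z)) \oc G2 (F0 x \b0 F0 y) (F0 z).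
  have := bilin_natiso_natural nG (F2 x y) (idm (F0 z)).
  by rewrite /= !R !src_id !tgt_id (functor_id fG).
transitivity (G1 (F2 x (y \b0 z) \oc (idm (F0 x) \b1 F2 y z))
    \oc (G2 (F0 x) (F0 y \b0 F0 z) \oc (idm (G0 (F0 x)) \b1 G2 (F0 y) (F0 z))
    \oc assoc (G0 (F0 x)) (G0 (F0 y)) (G0 (F0 z)))).
  rewrite mul1_id_compm; last by ends R.
  rewrite (functor_comp fG); last by ends R.
  rewrite -!compmA; [|by ends R ..].
  by rewrite (compmA (g := idm _ \b1 _)) ?natl -?compmA; ends R.
rewrite cG.
transitivity (G1 (F2 x (y \b0 z) \oc (idm (F0 x) \b1 F2 y z)
    \oc assoc (F0 x) (F0 y) (F0 z))
    \oc (G2 (F0 x \b0 F0 y) (F0 z) \oc (G2 (F0 x) (F0 y) \b1 idm (G0 (F0 z))))).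
  rewrite [in RHS](functor_comp fG); last by ends R.
  by rewrite -!compmA; ends R.
rewrite cF mul1_compm_id; last by ends R.
rewrite !(functor_comp fG); try by ends R.
rewrite -!compmA; [|by ends R ..].
by rewrite (compmA (h := G2 _ _)) ?natr -?compmA; ends R.
Qed.

End Ass2Comp.

(** * Homomorphisms of difference associative 2-algebras *)

(** The shape (x + x') (y + y') - x y of the difference rule. It is taken for any
    operation m, because the right-hand side of the coherence of a homomorphism
    consists of two such expressions: one for hom2 at x, D x and y, D y, and one
    for the product of arrows at 1, hom3 x and 1, hom3 y. *)
Definition leibniz (U V : Type) (Z : nmodType) (m : U -> V -> Z)
  (x x' : U) (y y' : V) : Z := m x' y + m x y' + m x' y'.

(** Each of the three summands is a product of composites, hence a composite of
    products by bifunctoriality, and the interchange law adds them up. *)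
Lemma mul1_leibniz (k : fieldType) (C : ass2 k) (x y : ob C)
    (f' f g' g : mor C) :
  src f' = tgt f -> src g' = tgt g ->
  leibniz mul1 (idm x) (f' \oc f) (idm y) (g' \oc g)
  = leibniz mul1 (idm x) f' (idm y) g' \oc leibniz mul1 (idm x) f (idm y) g.
Proof.
move=> ef eg; rewrite /leibniz mul1_compm_id // mul1_id_compm // mul1_compm //.
have R := (@src_mul1 k C, @tgt_mul1 k C, ef, eg).
by rewrite !compmD; ends R.
Qed.

Section DiffAss2.
Variables (k : fieldType) (C : diff_ass2 k).
Implicit Types (f g : mor C) (x y : ob C).

Lemma dif_functor : is_functor (@dif0 k C) (@dif1 k C).
Proof. exact: difference_functor (dif_is_difference C). Qed.

Lemma src_dif2 x y : src (dif2 x y) = dif0 (x \b0 y).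
Proof.
have n := difference_natiso (dif_is_difference C).
exact: (proj1 (bilin_natiso_arrow n x y)).
Qed.

Lemma tgt_dif2 x y :
  tgt (dif2 x y) = dif0 x \b0 y + x \b0 dif0 y + dif0 x \b0 dif0 y.
Proof.
have n := difference_natiso (dif_is_difference C).
exact: (proj2 (bilin_natiso_arrow n x y)).
Qed.

Lemma id_diff_hom : is_diff_hom (id_data C).
Proof.
have R := (src_dif2, tgt_dif2, functor_src dif_functor, functor_tgt dif_functor,
  @src_mul1 k C, @tgt_mul1 k C).
split; first exact: id_ass2_hom.
  apply: lin_natiso_id; exact: (functor_ends dif_functor).
move=> x y /=; rewrite (functor_id dif_functor) !mul1_id -!linearD.
by rewrite !comp1m ?compm1; ends R.
Qed.

End DiffAss2.

Section DiffComp.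
Variables (k : fieldType) (A B C : diff_ass2 k).
Variables (G : hom_data B C) (F : hom_data A B).
Hypotheses (hG : is_diff_hom G) (hF : is_diff_hom F).

Let H := comp_data G F.

(** Write S, T for the two Leibniz sums of F, and GS, GT for those of G at the
    objects X = F0 x and Y = F0 y. Naturality of G3 at F2(x, y) splits the left
    side into the G1-image of the left side for F, followed on the right by the
    left side for G at X, Y without its first factor. Coherence of F replaces
    the image by G1 S, G1 T and the G1-image of the missing factor; coherence of
    G then produces G1 S, G1 T, GS, GT. It remains to exchange G1 T and GS,
    which is naturality of G2, and to recognise the two outer pairs as the
    Leibniz sums of the composite. *)
Lemma comp_diff_hom : is_diff_hom H.
Proof.
have [aF n3F cF] := hF; have [aG n3G cG] := hG.
have [fF n2F _] := aF; have [fG n2G _] := aG.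
have dA := dif_functor A; have dB := dif_functor B; have dC := dif_functor C.
have sF2 x y := proj1 (bilin_natiso_arrow n2F x y).
have tF2 x y := proj2 (bilin_natiso_arrow n2F x y).
have sG2 x y := proj1 (bilin_natiso_arrow n2G x y).
have tG2 x y := proj2 (bilin_natiso_arrow n2G x y).
have sF3 x := proj1 (lin_natiso_arrow n3F x).
have tF3 x := proj2 (lin_natiso_arrow n3F x).
have sG3 x := proj1 (lin_natiso_arrow n3G x).
have tG3 x := proj2 (lin_natiso_arrow n3G x).
have R := (functor_src fF, functor_tgt fF, functor_src fG, functor_tgt fG,
  functor_src dA, functor_tgt dA, functor_src dB, functor_tgt dB,
  functor_src dC, functor_tgt dC, (sF2, tF2, sG2, tG2, sF3, tF3, sG3, tG3),
  src_mul1, tgt_mul1, src_dif2, tgt_dif2).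
split; first exact: comp_ass2_hom.
  have nGF := lin_natiso_pre fF n3G.
  have GnF := lin_natiso_post fG _ _ n3F.
  apply: lin_natiso_vcomp nGF (GnF _ _) => f; split; by ends R.
move=> x y.
pose X := hom0 F x; pose Y := hom0 F y.
pose S := leibniz (hom2 F) x (dif0 x) y (dif0 y).
pose T := leibniz mul1 (idm X) (hom3 F x) (idm Y) (hom3 F y).
pose GS := leibniz (hom2 G) X (dif0 X) Y (dif0 Y).
pose GT := leibniz mul1 (idm (hom0 G X)) (hom3 G X) (idm (hom0 G Y)) (hom3 G Y).
(* What GS and G1 T become in the exchange by naturality of G2. *)
pose GS' := leibniz (hom2 G) X (hom0 F (dif0 x)) Y (hom0 F (dif0 y)).
pose T' := leibniz mul1 (idm (hom0 G X)) (hom1 G (hom3 F x))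
  (idm (hom0 G Y)) (hom1 G (hom3 F y)).
have natG3 : hom3 G (hom0 F (x \b0 y)) \oc dif1 (hom1 G (hom2 F x y))
    = hom1 G (dif1 (hom2 F x y)) \oc hom3 G (X \b0 Y).
  by have := lin_natiso_natural n3G (hom2 F x y); rewrite /= !R.
have natGS : hom1 G T \oc GS = GS' \oc T'.
  have natG2 f g := esym (bilin_natiso_natural n2G f g).
  rewrite /T /GS /GS' /T' /leibniz !linearD /= -!compmD; try by ends R.
  have := natG2 (hom3 F x) (idm Y); have := natG2 (idm X) (hom3 F y).
  have := natG2 (hom3 F x) (hom3 F y).
  by rewrite /= !R !src_id !tgt_id !(functor_id fG) => -> -> ->.
have ST : src S = tgt T by rewrite /S /T /leibniz; ends R.
have TD : src T = tgt (dif2 X Y) by rewrite /T /leibniz; ends R.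
have TGS : tgt GS = hom0 G (src T) by rewrite /T /GS /leibniz; ends R.
have SGS' : tgt GS' = hom0 G (src S) by rewrite /S /GS' /leibniz; ends R.
have GST : src GS = tgt GT by rewrite /GS /GT /leibniz; ends R.
have GTD : src GT = tgt (dif2 (hom0 G X) (hom0 G Y)).
  by rewrite /GT /leibniz; ends R.
have GST' : src GS' = tgt T' by rewrite /GS' /T' /leibniz; ends R.
have TGT' : src T' = tgt GT by rewrite /GT /T' /leibniz; ends R.
have eS : leibniz (hom2 H) x (dif0 x) y (dif0 y) = hom1 G S \oc GS'.
  by rewrite /S /GS' /leibniz !linearD /= -!compmD //; ends R.
have eT : leibniz mul1 (idm (hom0 H x)) (hom3 H x) (idm (hom0 H y)) (hom3 H y)
    = T' \oc GT.
  by rewrite -mul1_leibniz; ends R.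
rewrite -/(leibniz (hom2 H) x (dif0 x) y (dif0 y)) eS.
rewrite -/(leibniz mul1 (idm (hom0 H x)) (hom3 H x) (idm (hom0 H y))
  (hom3 H y)) eT.
have {}cF : hom1 F (dif2 x y) \oc hom3 F (x \b0 y) \oc dif1 (hom2 F x y)
  = S \oc T \oc dif2 X Y := cF x y.
have {}cG : hom1 G (dif2 X Y) \oc hom3 G (X \b0 Y) \oc dif1 (hom2 G X Y)
  = GS \oc GT \oc dif2 (hom0 G X) (hom0 G Y) := cG X Y.
(* From here on only the ends of the six sums matter. *)
clearbody S T GS GT GS' T'.
have RS := (functor_src fG, functor_tgt fG, ST, TD, TGS, SGS',
  GST, GTD, GST', TGT').
transitivity (hom1 G (hom1 F (dif2 x y) \oc hom3 F (x \b0 y)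
      \oc dif1 (hom2 F x y))
    \oc (hom3 G (X \b0 Y) \oc dif1 (hom2 G X Y))).
  rewrite /= (functor_comp dC); last by ends R.
  rewrite !(functor_comp fG); [|by ends R ..].
  rewrite -!compmA; [|by ends R ..].
  by rewrite (compmA (h := hom3 G _)) ?natG3 -?compmA; ends R.
transitivity (hom1 G S \oc hom1 G T
    \oc (hom1 G (dif2 X Y) \oc hom3 G (X \b0 Y) \oc dif1 (hom2 G X Y))).
  rewrite cF !(functor_comp fG); [|by ends RS ..].
  by rewrite -!compmA //; ends (RS, R).
rewrite cG.
transitivity (hom1 G S \oc (hom1 G T \oc GS) \oc GT
    \oc dif2 (hom0 G X) (hom0 G Y)).
  by rewrite -!compmA //; ends RS.
by rewrite natGS -!compmA //; ends RS.
Qed.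

End DiffComp.

(** * The category *)

Lemma linear_ext (k : fieldType) (U V : lmodType k) (f g : {linear U -> V}) :
  f =1 g -> f = g.
Proof.
case: f => f [[fD] [fZ]]; case: g => g [[gD] [gZ]] /=.
move=> /functional_extensionality e; case: _ / e in gD gZ *.
by rewrite (proof_irrelevance _ fD gD) (proof_irrelevance _ fZ gZ).
Qed.

Lemma hom_data_ext (k : fieldType) (A B : diff_ass2 k) (F G : hom_data A B) :
  hom0 F =1 hom0 G -> hom1 F =1 hom1 G -> hom2 F =2 hom2 G ->
  hom3 F =1 hom3 G -> F = G.
Proof.
case: F => F0 F1 F2 F3; case: G => G0 G1 G2 G3 /=.
move=> /linear_ext -> /linear_ext -> e2 /functional_extensionality ->.
congr HomData; apply: functional_extensionality => x.
exact: functional_extensionality (e2 x).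
Qed.

Lemma diff_hom_ext (k : fieldType) (A B : diff_ass2 k) (F G : diff_hom A B) :
  diff_hom_data F = diff_hom_data G -> F = G.
Proof.
case: F => F hF; case: G => G hG /= e; case: _ / e in hG *.
by rewrite (proof_irrelevance _ hF hG).
Qed.

(* The specified identities and composites are homomorphisms, and they make
   difference associative 2-algebras and their homomorphisms a category. *)
Theorem theorem3p3 (k : fieldType) (char0 : [pchar k] =i pred0) :
  exists (ident : forall A : diff_ass2 k, diff_hom A A)
         (cmp : forall A B C : diff_ass2 k,
            diff_hom B C -> diff_hom A B -> diff_hom A C),
    [/\ forall A : diff_ass2 k, diff_hom_data (ident A) = id_data A,
        forall (A B C : diff_ass2 k) (G : diff_hom B C) (F : diff_hom A B),
          diff_hom_data (cmp A B C G F) = comp_data G F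
      & is_category ident cmp].
Proof.
exists (fun A => DiffHom (id_diff_hom A)).
exists (fun A B C G F =>
  DiffHom (comp_diff_hom (diff_hom_is_hom G) (diff_hom_is_hom F))).
split=> //; split=> [A B F|A B F|A B C D H G F];
  apply: diff_hom_ext; apply: hom_data_ext => //=.
- move=> x y /=; apply: compm1.
  have [[_ n _] _ _] := diff_hom_is_hom F.
  exact: (proj1 (bilin_natiso_arrow n x y)).
- move=> x /=; apply: compm1.
  have [_ n _] := diff_hom_is_hom F; exact: (proj1 (lin_natiso_arrow n x)).
- have [[f n _] _ _] := diff_hom_is_hom F.
  move=> x y /=; rewrite (functor_id f) comp1m //.
  exact: (proj2 (bilin_natiso_arrow n x y)).
- have [[f _ _] n _] := diff_hom_is_hom F.
  move=> x /=; rewrite (functor_id f) comp1m //.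
  exact: (proj2 (lin_natiso_arrow n x)).
- have [[_ n2F _] _ _] := diff_hom_is_hom F.
  have [[fG n2G _] _ _] := diff_hom_is_hom G.
  have [[fH n2H _] _ _] := diff_hom_is_hom H.
  move=> x y /=; apply: (functor_compmA fH).
    rewrite (functor_src fG) (proj1 (bilin_natiso_arrow n2F x y)).
    by rewrite (proj2 (bilin_natiso_arrow n2G _ _)).
  rewrite (proj1 (bilin_natiso_arrow n2G _ _)).
  by rewrite (proj2 (bilin_natiso_arrow n2H _ _)).
- have [_ n3F _] := diff_hom_is_hom F.
  have [[fG _ _] n3G _] := diff_hom_is_hom G.
  have [[fH _ _] n3H _] := diff_hom_is_hom H.
  move=> x /=; apply: (functor_compmA fH).
    rewrite (functor_src fG) (proj1 (lin_natiso_arrow n3F x)).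
    by rewrite (proj2 (lin_natiso_arrow n3G _)).
  rewrite (proj1 (lin_natiso_arrow n3G _)).
  by rewrite (proj2 (lin_natiso_arrow n3H _)).
Qed.
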